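(* Suppose $(G,\|\cdot\|)$ is a finitely generated group equipped with a norm, $H$ is an expanding group endomorphism of $G$ with $H(G)$ of finite index in $G$, and $V$ is a good complete digit set with respect to $H$. Let $\Lambda$ be a finite set (identified with a finite subset of $\mathbb R$). If $G$ is also amenable, then any $(V,H)$-automatic $x\in\Lambda^G$ is strongly deterministic.
   Context: A norm on $G$ is a map $\|\cdot\|:G\to[0,\infty)$ with $\|g\|=0$ iff $g=e$, $\|g\|=\|g^{-1}\|$, and $\|gg'\|\le\|g\|+\|g'\|$ for all $g,g'\in G$. An endomorphism $H:G\to G$ is expanding if there is $C>1$ with $\|H(g)\|\ge C\|g\|$ for all $g\neq e$. $G$ is infinite. Let $H$ be expanding with $H(G)$ of finite index. A set $V\subset G$ is a residue set if $e\in V$ and for each $g\in G$ there are unique $v\in V$ and $g'\in G$ with $g=vH(g')$. A residue set $V$ is a complete digit set if each $g\in G\setminus\{e\}$ has a finite representation $$g=v_0H(v_1)H^2(v_2)\cdots H^n(v_n),\qquad v_i\in V,\ v_n\neq e$$ (necessarily unique); put $\mathsf{Ord}(g)=n$, and $\mathsf{Ord}(e)=0$. A complete digit set is good if there exists $n_0$ such that whenever $\mathsf{Ord}(g)\le n$ and $\mathsf{Ord}(g')\le n$ one has $\mathsf{Ord}(gg')\le n+n_0$. $x\in\Lambda^G$ is $(V,H)$-automatic if there exist a finite set $S$ with a distinguished element $s_0\in S$, maps $\alpha_v:S\to S$ ($v\in V$) and a map $\omega:S\to\Lambda$ such that $x(e)=\omega(s_0)$ and for each $g\in G\setminus\{e\}$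 with representation $g=v_0H(v_1)H^2(v_2)\cdots H^n(v_n)$, where $v_i\in V$ and $v_n\neq e$, $x(g)=\omega(\alpha_{v_0}\circ\alpha_{v_1}\circ\cdots\circ\alpha_{v_n}(s_0))$. A F\o lner sequence in $G$ is a sequence $(F_n)$ of nonempty finite sets with $|KF_n\triangle F_n|/|F_n|\to0$ for every nonempty finite $K\subset G$; $G$ is amenable if it has one. A dynamical system $(X,G)$ is an action of $G$ by continuous maps on a compact metric space $X$. For an invariant Borel probability measure $\mu$ its entropy is $h(\mu)=\sup_{\mathcal P}\lim_n\frac1{|F_n|}H\big(\mu,\bigvee_{g\in F_n}g^{-1}(\mathcal P)\big)$ ($\mathcal P$ over finite measurable partitions; $H(\mu,\cdot)$ here is Shannon entropy; independent of the F\o lner sequence), and the topological entropy of $(X,G)$ is $\sup_\mu h(\mu)$ over invariant measures. A function $f:G\to\mathbb R$ is strongly deterministic if there are a dynamical system $(X,G)$ of topological entropy zero, a continuous $\varphi:X\to\mathbb R$ and $x_0\in X$ with $f(g)=\varphi(g(x_0))$ for all $g\in G$. *)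

(* Defs.v *)
From HB Require Import structures.
From mathcomp Require Import all_boot all_order all_algebra finmap.
From mathcomp Require Import all_classical all_reals all_analysis.

Set Implicit Arguments.
Unset Strict Implicit.
Unset Printing Implicit Defensive.

Import Order.TTheory GRing.Theory Num.Theory.
Import numFieldNormedType.Exports.

Local Open Scope classical_set_scope.
Local Open Scope ring_scope.

Section GroupNotions.
Context {G : groupType}.

Definition finitely_generated : Prop :=
  exists2 S : set G, finite_set S &
    smallest (fun K : set G => group_closed (mem K)) S = [set: G].

Definition finite_index (K : set G) : Prop :=
  finite_set (range (fun g : G => [set (g * k)%g | k in K])).

Definition group_norm (R : realType) (N : G -> R) : Prop :=
  [/\ forall g, 0 <= N g,
      forall g, N g = 0 <-> g = 1%g,
      forall g, N (g^-1)%g = N g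
    & forall g h, N (g * h)%g <= N g + N h].

Definition expanding (R : realType) (N : G -> R) (H : G -> G) : Prop :=
  exists2 C : R, 1 < C & forall g, g <> 1%g -> C * N g <= N (H g).

End GroupNotions.

Arguments finitely_generated : clear implicits.

Section Digits.
Context {G : groupType} (H : G -> G) (V : set G).

Definition residue_set : Prop :=
  V 1%g /\ forall g, exists! p : G * G, V p.1 /\ g = (p.1 * H p.2)%g.

(* [:: v_0; ...; v_n] is sent to v_0 H(v_1) ... H^n(v_n). *)
Definition digit_value (s : seq G) : G :=
  (\prod_(0 <= i < size s) iter i H (s`_i))%g.

(* The empty list is excluded by the condition on its last element, whose
   default value is 1. *)
Definition represents (g : G) (s : seq G) : Prop :=
  [/\ [set` s] `<=` V, last 1%g s <> 1%g & g = digit_value s].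

Definition complete_digit_set : Prop :=
  residue_set /\ forall g, g <> 1%g -> exists s, represents g s.

(* For a complete digit set and an expanding H the representation is unique,
   so that the choice made by xget is immaterial. *)
Definition Ord (g : G) : nat :=
  if g == 1%g then 0%N else (size (xget [::] (represents g))).-1.

Definition good_complete_digit_set : Prop :=
  complete_digit_set /\
  exists n0 : nat, forall (n : nat) (g h : G),
    (Ord g <= n)%N -> (Ord h <= n)%N -> (Ord (g * h)%g <= n + n0)%N.

(* Only the maps alpha v with v in V are ever used, so letting alpha be
   defined on all of G does not matter. *)
Definition automatic (Lam : Type) (x : G -> Lam) : Prop :=
  exists (S : finType) (s0 : S) (alpha : G -> S -> S) (omega : S -> Lam),
    x 1%g = omega s0 /\
    forall g s, g <> 1%g -> represents g s -> x g = omega (foldr alpha s0 s).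

End Digits.

Section Amenability.
Context (R : realType) {G : groupType}.

Definition folner (F : nat -> {fset G}) : Prop :=
  (forall n, F n != fset0) /\
  forall K : {fset G}, K != fset0 ->
    (let KF n := [fset (k * f)%g | k in K, f in F n]%fset in
     #|` ((KF n `\` F n) `|` (F n `\` KF n))%fset|%:R / #|` F n|%:R : R)
      @[n --> \oo] --> (0 : R).

End Amenability.

Definition amenable (R : realType) (G : groupType) : Prop :=
  exists F : nat -> {fset G}, folner R F.

(* Measurable types are pointed in the library; a phase space containing a
   point x_0 can always be pointed. *)
#[short(type="pmetricType")]
HB.structure Definition PointedMetric (R : numDomainType) :=
  {T of Pointed T & Metric R T}.

Notation borel X := (g_sigma_algebraType (@open X)).

Section Dynamics.
Context {R : realType} {G : groupType} {X : pmetricType R}.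
Implicit Types (a : G -> X -> X) (mu : probability (borel X) R).

Definition dynamical_system a : Prop :=
  [/\ compact [set: X],
      forall x, a 1%g x = x,
      forall g h x, a (g * h)%g x = a g (a h x)
    & forall g, continuous (a g)].

Definition invariant_measure a mu : Prop :=
  forall (g : G) (A : set (borel X)), measurable A -> mu (a g @^-1` A) = mu A.

Definition measurable_partition (k : nat) (P : 'I_k -> set X) : Prop :=
  partition [set: 'I_k] P [set: X] /\
  forall i, measurable (P i : set (borel X)).

(* Empty cells contribute 0. *)
Definition shannon_entropy mu (J : finType) (Q : J -> set X) : R :=
  - \sum_(j : J) fine (mu (Q j)) * ln (fine (mu (Q j))).

(* The cells of the join over g in F of the partitions g^-1(P), indexed by the
   functions c from F to the cells of P; some of them may be empty. *)
Definition join_cell a (k : nat) (P : 'I_k -> set X) (F : {fset G})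
    (c : {ffun F -> 'I_k}) : set X :=
  \bigcap_(g in [set: F]) (a (val g) @^-1` P (c g)).

(* For an invariant measure and a Folner sequence the limit exists by the
   Ornstein-Weiss lemma. *)
Definition partition_entropy (F : nat -> {fset G}) a mu
    (k : nat) (P : 'I_k -> set X) : R :=
  limn (fun n => shannon_entropy mu (join_cell a P (F := F n)) / #|` F n|%:R).

Definition measure_entropy (F : nat -> {fset G}) a mu : \bar R :=
  ereal_sup [set h | exists (k : nat) (P : 'I_k -> set X),
    measurable_partition P /\ h = (partition_entropy F a mu P)%:E].

Definition topological_entropy (F : nat -> {fset G}) a : \bar R :=
  ereal_sup [set measure_entropy F a mu | mu in invariant_measure a].

(* Entropy does not depend on the Folner sequence and is only defined for
   amenable groups. *)
Definition zero_entropy a : Prop :=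
  amenable R G /\
  forall F : nat -> {fset G}, folner R F -> topological_entropy F a = 0%E.

End Dynamics.

Definition strongly_deterministic (R : realType) (G : groupType)
    (f : G -> R) : Prop :=
  exists (X : pmetricType R) (a : G -> X -> X) (phi : X -> R) (x0 : X),
    [/\ dynamical_system a, zero_entropy a, continuous phi
      & forall g, f g = phi (a g x0)].

(* Main.v *)
Require Import Defs.
From HB Require Import structures.
From mathcomp Require Import all_boot all_order all_algebra finmap.
From mathcomp Require Import all_classical all_reals all_analysis.
From mathcomp Require Import ring lra.

(** The phase space is the closure in Lam^G of the orbit of x under the shift
    (g y)(h) = y (h g), together with one constant configuration. It is a compact
    metric space, x is recovered as phi (g x) with phi y = iota (y 1), and the Dirac
    mass at the constant configuration is an invariant measure. It remains to see
    that every invariant measure has entropy zero, for every Folner sequence F n.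

    Automaticity enters through linear complexity along an exact tiling. Let tile m
    be the set of all products v_0 H(v_1) ... H^(m-1)(v_(m-1)) of digits. Since V is
    a residue set, G is the disjoint union of the sets (tile m) b with b in the
    image of H^m. Since V is good, the word that x shows on a translate of tile m
    is determined by an element of tile m and a bounded number of states of the
    automaton, so at most C #|tile m| words occur (automatic_complexity). As G is
    infinite the tiles are arbitrarily large, and the logarithm of the number of
    words becomes small compared with the size of the tile.

    Let P be a finite measurable partition of the phase space. Up to a set of small
    measure the index of the cell of a point is a function D of finitely many
    coordinates (partition_local_approx). The values of D along F n depend on the
    coordinates in a finite thickening of F n, which the Folner property makes
    coverable by about #|F n| / #|tile m| tiles. So these values are determined by a
    code that takes exp (o(#|F n|)) values (pattern_code). A coding argument based
    on the Gibbs inequality turns this count, and the small discrepancy between D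
    and P, into a bound o(#|F n|) for the Shannon entropy of the join of P over F n
    (entropy_code_bound). *)

Set Implicit Arguments.
Unset Strict Implicit.
Unset Printing Implicit Defensive.

Import Order.TTheory GRing.Theory Num.Theory.
Import numFieldNormedType.Exports.

Local Open Scope classical_set_scope.

(** * Tiles of a digit system and automatic functions *)

Section Tiles.
Local Open Scope group_scope.
Context {G : groupType} (H : {multiplicative G -> G}) (V : set G).
Hypothesis V_residue : residue_set H V.

Lemma multiplicative1 : H 1 = 1.
Proof. by apply: (@mulgI _ (H 1)); rewrite -gmulfM !mulg1. Qed.

(** The uniqueness clause of a residue set also makes H injective, which is what
    later allows an argument to peel digits off one at a time. *)
Lemma residue_uniq v v' k k' : V v -> V v' -> v * H k = v' * H k' ->
  v = v' /\ k = k'.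
Proof.
move=> Vv Vv' e; have [_ /(_ (v * H k))[p [_ pU]]] := V_residue.
have ep : p = (v, k) by exact: pU.
have : p = (v', k') by exact: pU.
by rewrite ep => -[-> ->].
Qed.

Lemma residue_eq1 v k : V v -> (v * H k == 1) = (v == 1) && (k == 1).
Proof.
move=> Vv; apply/eqP/andP => [e|[/eqP-> /eqP->]]; last first.
  by rewrite multiplicative1 mulg1.
have [->->//] : v = 1 /\ k = 1.
by apply: residue_uniq => //; [exact: V_residue.1|rewrite multiplicative1 mulg1].
Qed.

(** Distinct digits lie in distinct left cosets of the image of H, so V is at
    most as large as the index of that image. *)
Lemma residue_set_finite : finite_index (range H) -> finite_set V.
Proof.
pose coset (g : G) := [set (g * k)%g | k in range H].
move=> /(finite_image (fun C => xget 1 (V `&` C))); apply: sub_finite_set.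
move=> v Vv; exists (coset v); first by exists v.
suff : (V `&` coset v) (xget 1 (V `&` coset v)).
  move=> [Vw [_ [k _ <-] e]].
  have [] // := @residue_uniq v (xget 1 (V `&` coset v)) k 1 Vv Vw.
  by rewrite multiplicative1 mulg1 e.
apply: (@xgetPex _ 1 (V `&` coset v)); exists v; split=> //.
by exists 1; rewrite ?mulg1//; exists 1; rewrite ?multiplicative1.
Qed.

(** The products v_0 H(v_1) ... H^(m-1)(v_(m-1)) of m digits, trailing digits 1
    being allowed. Hence the tiles increase with m, and Ord g <= n means that g
    lies in tile n.+1. *)
Fixpoint tile (m : nat) : {fset G} :=
  if m is m'.+1 then [fset v * H u | v in fset_set V, u in tile m']%fset
  else [fset 1]%fset.

Hypothesis V_finite : finite_set V.

Lemma mem_tileS m g : g \in tile m.+1 <->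
  exists v u, [/\ V v, u \in tile m & g = v * H u].
Proof.
split => [/imfset2P[v vV [u um ->]]|[v [u [Vv um ->]]]].
  by exists v, u; split => //; move: vV; rewrite /= in_fset_set// inE.
by apply/imfset2P; exists v; [rewrite /= in_fset_set// inE|exists u].
Qed.

Lemma residue_dec g : exists v k, V v /\ g = v * H k.
Proof.
by have [_ /(_ g)[[v k] [[/= Vv e] _]]] := V_residue; exists v, k.
Qed.

Lemma mem_tile_residue m v k : V v ->
  (v * H k \in tile m.+1) = (k \in tile m).
Proof.
move=> Vv; apply/idP/idP => [/mem_tileS[v' [u [Vv' um]]]|km].
  by move=> /residue_uniq[]// _ ->.
by apply/mem_tileS; exists v, k.
Qed.

Lemma tile1 m : 1 \in tile m.
Proof.
elim: m => [|m IH]; first by rewrite inE.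
apply/mem_tileS; exists 1, 1; split => //; first exact: V_residue.1.
by rewrite multiplicative1 mulg1.
Qed.

Lemma tile_add m n g : g \in tile (m + n) <->
  exists u t, [/\ u \in tile m, t \in tile n & g = u * iter m H t].
Proof.
elim: m g => [|m IH] g.
  split => [gn|[u [t [/fset1P-> tn ->]]]]; last by rewrite mul1g.
  by exists 1, g; rewrite mul1g; split => //; rewrite inE.
rewrite addSn; split => [/mem_tileS[v [k [Vv /IH[u [t [um tn ->]]] ->]]]|].
  exists (v * H u), t; split => //; first by rewrite mem_tile_residue.
  by rewrite gmulfM mulgA.
move=> [w [t [/mem_tileS[v [u [Vv um ->]]] tn ->]]].
by rewrite -mulgA -gmulfM mem_tile_residue//; apply/IH; exists u, t.
Qed.

Lemma tile_dec m g : exists u k, u \in tile m /\ g = u * iter m H k.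
Proof.
elim: m g => [|m IH] g; first by exists 1, g; rewrite inE mul1g.
have [v [g' [Vv ->]]] := residue_dec g.
have [u [k [um ->]]] := IH g'.
exists (v * H u), k; rewrite mem_tile_residue//; split=> //.
by rewrite gmulfM mulgA.
Qed.

(** Together with tile_dec: the right translates of tile m by the elements of the
    image of H^m form an exact tiling of G. *)
Lemma tile_uniq m u u' k k' : u \in tile m -> u' \in tile m ->
  u * iter m H k = u' * iter m H k' -> u = u' /\ k = k'.
Proof.
elim: m u u' => [|m IH] u u'; first by move=> /fset1P-> /fset1P->; rewrite !mul1g.
move=> /mem_tileS[v [w [Vv wm ->]]] /mem_tileS[v' [w' [Vv' wm' ->]]] /=.
rewrite -!mulgA -!gmulfM => /residue_uniq[]// -> /IH[]// -> ->.
by [].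
Qed.

Lemma digit_value_cons v s : digit_value H (v :: s) = v * H (digit_value H s).
Proof.
rewrite /digit_value /= big_nat_recl//= (big_morph H (@gmulfM _ _ H) multiplicative1).
by [].
Qed.

Lemma represents_cons g v s : s <> [::] -> represents H V g (v :: s) ->
  [/\ V v, represents H V (digit_value H s) s & g = v * H (digit_value H s)].
Proof.
move=> s0 [sV l ->]; rewrite -digit_value_cons; split=> //.
  by apply: sV; rewrite /= inE eqxx.
split=> //; last by case: s s0 l {sV}.
by move=> w ws; apply: sV; rewrite /= inE; apply/orP; right.
Qed.

Lemma represents_consr k v s : V v -> represents H V k s ->
  represents H V (v * H k) (v :: s).
Proof.
move=> Vv [sV sl ->]; split; last by rewrite digit_value_cons.
  by move=> w /=; rewrite inE => /orP[/eqP->|]; last exact: sV.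
by case: s sl {sV}.
Qed.

Lemma represents_seq1 g v : represents H V g [:: v] -> [/\ V v, v <> 1 & g = v].
Proof.
move=> [sV l ->]; split=> //; first by apply: sV; rewrite /= inE.
by rewrite digit_value_cons /digit_value/= big_geq// multiplicative1 mulg1.
Qed.

Lemma represents_neq1 g s : represents H V g s -> g != 1.
Proof.
elim: s g => [|v s IH] g; first by case.
case: s IH => [|w s] IH; first by move=> /represents_seq1[_ /eqP ? ->].
move=> /represents_cons[]// Vv sr ->; rewrite residue_eq1// negb_and.
by rewrite (IH _ sr) orbT.
Qed.

Lemma represents_uniq g s s' : represents H V g s -> represents H V g s' -> s = s'.
Proof.
have nil g1 : ~ represents H V g1 [::] by case.
elim: s s' g => [|v s IH] s' g; first by move=> /nil.
case: s' => [|v' s']; first by move=> _ /nil.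
case: s IH => [|w s] IH; case: s' => [|w' s'].
- by move=> /represents_seq1[_ _ ->] /represents_seq1[_ _ ->].
- move=> /represents_seq1[Vv v1 ->] /represents_cons[]// Vv' sr.
  rewrite -{1}(mulg1 v) -multiplicative1 => /residue_uniq[]// _ e.
  by move: (represents_neq1 sr); rewrite -e eqxx.
- move=> /represents_cons[]// Vv' sr e /represents_seq1[Vv v1].
  rewrite e -{1}(mulg1 v') -multiplicative1 => /residue_uniq[]// _ {}e.
  by move: (represents_neq1 sr); rewrite e eqxx.
move=> /represents_cons[]// Vv sr -> /represents_cons[]// Vv' sr'.
move=> /residue_uniq[]// <- e.
by rewrite -e in sr'; rewrite (IH _ _ sr sr').
Qed.

Lemma mem_tile_represents g s m : represents H V g s ->
  (g \in tile m) = (size s <= m)%N.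
Proof.
elim: s g m => [|v s IH] g m; first by case.
move=> gs; case: m => [|m].
  by rewrite inE (negbTE (represents_neq1 gs)).
case: s IH gs => [|w s] IH.
  move=> /represents_seq1[Vv _ ->]; rewrite -[v in LHS]mulg1 -multiplicative1.
  by rewrite mem_tile_residue// tile1.
by move=> /represents_cons[]// Vv sr ->; rewrite mem_tile_residue// (IH _ _ sr).
Qed.

Hypothesis V_complete : complete_digit_set H V.

Lemma Ord_leq g n : (Ord H V g <= n)%N = (g \in tile n.+1).
Proof.
rewrite /Ord; have [->|/eqP g1] := eqVneq g 1; first by rewrite tile1.
have [s gs] := V_complete.2 _ g1.
have : represents H V g (xget [::] (represents H V g)).
  by apply: (xgetPex [::]); exists s.
case: (xget _ _) => [|v t] gt; first by case: gt.
by rewrite (mem_tile_represents _ gt).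
Qed.

(** A representation ends with a digit other than 1, so the given automaton may
    react to a trailing digit 1. A new state None, reserved for the identity of
    the group and fixed by the digit 1, repairs this: the state theta becomes a
    function of the group element that obeys theta (v H(k)) = step v (theta k)
    without exception. *)
Lemma automatic_padding (Lam : Type) (x : G -> Lam) : automatic H V x ->
  exists (T : finType) (theta : G -> T) (step : G -> T -> T) (out : T -> Lam),
    (forall v k, V v -> theta (v * H k) = step v (theta k)) /\
    forall g, x g = out (theta g).
Proof.
move=> [S [s0 [alpha [omega [x1 xs]]]]].
pose rep g := xget [::] (represents H V g).
have repP g : g <> 1 -> represents H V g (rep g).
  by move=> g1; apply: (xgetPex [::]); exact: V_complete.2.
pose theta g := if g == 1 then None else Some (foldr alpha s0 (rep g)).
exists (option S), theta,
  (fun v t => if (v == 1) && (t == None) then None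
              else Some (alpha v (odflt s0 t))),
  (fun t => omega (odflt s0 t)).
split=> [v k Vv|g]; last first.
  rewrite /theta; have [->//|/eqP g1] := eqVneq g 1.
  by rewrite /= (xs _ _ g1 (repP _ g1)).
rewrite /theta residue_eq1//.
have [->/=|k1] := eqVneq k 1; have [->/=|v1] := eqVneq v 1 => //=.
- have -> // : rep (v * H 1) = [:: v].
  apply: (@represents_uniq (v * H 1)).
    by apply: repP; apply/eqP; rewrite residue_eq1// negb_and v1.
  split => /=; [by move=> w /=; rewrite inE => /eqP->|exact/eqP|].
  by rewrite digit_value_cons /digit_value big_geq.
- have r1 := represents_consr V_residue.1 (repP _ (elimN eqP k1)).
  rewrite (@represents_uniq _ _ _ (repP (1 * H k) _) r1)//=.
  exact/eqP/(represents_neq1 r1).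
- have r1 := represents_consr Vv (repP _ (elimN eqP k1)).
  rewrite (@represents_uniq _ _ _ (repP (v * H k) _) r1)//=.
  exact/eqP/(represents_neq1 r1).
Qed.

Lemma tile_unbounded n : infinite_set [set: G] ->
  exists2 m, (0 < m)%N & (n <= #|` tile m|)%N.
Proof.
move=> /(infinite_set_fset n)[B _ nB].
suff [m Bm] : exists m, (B `<=` tile m.+1)%fset.
  by exists m.+1 => //; rewrite (leq_trans nB)// fsubset_leq_card.
pose M := (\max_(g : B) Ord H V (val g))%N.
exists M; apply/fsubsetP => g gB; rewrite -Ord_leq.
exact: (@leq_bigmax _ (fun g : B => Ord H V (val g)) [` gB]%fset).
Qed.

(** The words that x shows on the translates of tile m are at most C times as
    many as the elements of that tile. Indeed, write a = w H^m(k) with w in tile m.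
    For h in the tile, goodness puts h w into tile (m + n0), that is
    h w = u H^m(t) with u in tile m and t in tile n0, so h a = u H^m(t k). The
    letter x (h a) is determined by u and the state theta (t k). Hence w and the
    states theta (t k), for t in the fixed finite set tile n0, determine the whole
    word. *)
Lemma automatic_complexity (Lam : Type) (x : G -> Lam) :
  good_complete_digit_set H V -> automatic H V x ->
  exists C : nat, forall m, (0 < m)%N ->
    exists (E : finType) (dec : E -> G -> Lam),
      #|E| = (#|` tile m| * C)%N /\
      forall a, exists e, forall h, h \in tile m -> x (h * a) = dec e h.
Proof.
move=> [_ [n0 good]] /automatic_padding[T [theta [step [out [thetaE xE]]]]].
have thetaX m u k k' : u \in tile m -> theta k = theta k' ->
    theta (u * iter m H k) = theta (u * iter m H k').
  elim: m u => [|m IH] u um ek; first by move: um => /fset1P->; rewrite !mul1g.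
  have [v [w [Vv wm ->]]] := (mem_tileS m u).1 um.
  by rewrite -!mulgA/= -!gmulfM !thetaE// (IH w).
exists #|{ffun tile n0 -> T}| => m m0.
pose split_at a := [set p : G * G | p.1 \in tile m /\ a = p.1 * iter m H p.2].
pose dec1 a := xget (1, 1) (split_at a).
have dec1P a : (dec1 a).1 \in tile m /\ a = (dec1 a).1 * iter m H (dec1 a).2.
  have [u [k uk]] := tile_dec m a.
  by apply: (@xgetPex _ (1, 1) (split_at a)); exists (u, k).
pose code a : tile m * {ffun tile n0 -> T} :=
  ([` (dec1P a).1]%fset, [ffun t => theta (val t * (dec1 a).2)]).
exists (tile m * {ffun tile n0 -> T})%type,
  (fun e h => x (h * xget 1 [set a | code a = e])).
(* Decoding goes through an arbitrary position with the given code, so it remains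
   to see that equal codes give equal words. *)
split=> [|a]; first by rewrite card_prod -cardfE.
exists (code a) => h hm; set a' := xget _ _.
have : code a' = code a by apply: (@xgetPex _ 1 [set b | code b = code a]); exists a.
move=> [w_eq /ffunP tau_eq]; rewrite !xE.
rewrite (dec1P a).2 (dec1P a').2 w_eq.
move: (dec1P a).1 => {w_eq} /=; set w := (dec1 a).1 => wm.
have : h * w \in tile (m + n0).
  by case: (m) m0 hm wm => // m' _; rewrite addSn -!Ord_leq; exact: good.
rewrite !mulgA => /tile_add[u [t [um tn ->]]].
have iterM k k' : iter m H (k * k') = iter m H k * iter m H k'.
  by elim: (m) => //= i ->; exact: gmulfM.
rewrite -!mulgA -!iterM; congr out; apply: thetaX => //.
by have := tau_eq [` tn]%fset; rewrite !ffunE => ->.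
Qed.

End Tiles.

Local Open Scope ring_scope.

(** * Subshifts as compact metric spaces *)

Definition pattern_closure (G : groupType) (L : Type) (O : set (G -> L)) : set (G -> L) :=
  [set y : G -> L | forall F : seq G, exists2 o : G -> L, O o & {in F, y =1 o}].

(** The closure of O in the product topology, pointed by a constant
    configuration of O; rk only serves to define the metric. *)
Record subshift (R : realType) (G : groupType) (L : finType) (rk : G -> nat)
    (O : set (G -> L)) (l : L) (Ol : O (fun=> l)) :=
  Subshift { point_of : G -> L ; point_ofP : pattern_closure O point_of }.

Section Subshift.
Context {R : realType} {G : groupType} {L : finType} (rk : G -> nat).
Context {O : set (G -> L)} {l : L} (Ol : O (fun=> l)).

Notation X := (subshift R rk Ol).
Implicit Types y z : X.

HB.instance Definition _ := gen_eqMixin X.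
HB.instance Definition _ := gen_choiceMixin X.

Lemma const_pattern_closure : pattern_closure O (fun=> l).
Proof. by move=> F; exists (fun=> l). Qed.

Definition const_point : X := Subshift R rk Ol const_pattern_closure.

HB.instance Definition _ := isPointed.Build X const_point.

Lemma point_of_inj : injective (@point_of R G L rk O l Ol).
Proof.
move=> [y yP] [z zP] /= e; case: z / e zP => zP.
by congr Subshift; exact: Prop_irrelevance.
Qed.

(** The distance between two configurations is 1 / (r + 1), where r is the least
    rank of a site at which they differ. Taking the supremum of these inverses
    together with 0 avoids a case distinction for equal configurations. *)
Definition diff_set y z : set R :=
  0 |` [set (rk g).+1%:R^-1 | g in [set g | point_of y g <> point_of z g]].

Lemma diff_set_has_sup y z : has_sup (diff_set y z).
Proof.
split; first by exists 0; left.
exists 1 => _ [->|[g _ <-]]; first exact: ler01.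
by rewrite invf_le1// ler1n.
Qed.

Definition shift_dist y z : R := sup (diff_set y z).

Lemma shift_dist_lb y z g : point_of y g <> point_of z g ->
  (rk g).+1%:R^-1 <= shift_dist y z.
Proof.
by move=> yzg; apply: sup_upper_bound; [exact: diff_set_has_sup|right; exists g].
Qed.

Lemma shift_dist_le y z c : 0 <= c ->
  (forall g, point_of y g <> point_of z g -> (rk g).+1%:R^-1 <= c) ->
  shift_dist y z <= c.
Proof.
move=> c0 yzc; apply: ge_sup; first by case: (diff_set_has_sup y z).
by move=> _ [->//|[g yzg <-]]; exact: yzc.
Qed.

Lemma shift_dist_ge0 y z : 0 <= shift_dist y z.
Proof. by apply: sup_upper_bound; [exact: diff_set_has_sup|left]. Qed.

Lemma shift_distxx y : shift_dist y y = 0.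
Proof.
by apply/eqP; rewrite eq_le shift_dist_ge0 andbT; exact: shift_dist_le.
Qed.

Lemma shift_dist_positivity y z : shift_dist y z = 0 -> y = z.
Proof.
move=> yz0; apply: point_of_inj; apply/funext => g; apply: contrapT => yzg.
by have := shift_dist_lb yzg; rewrite yz0 leNgt invr_gt0 ltr0n.
Qed.

Lemma shift_dist_sym y z : shift_dist y z = shift_dist z y.
Proof.
congr sup; congr (_ `|` _); congr image.
by apply/seteqP; split => g /= yz zy; apply: yz.
Qed.

Lemma shift_dist_triangle z y w : shift_dist y w <= shift_dist y z + shift_dist z w.
Proof.
apply: shift_dist_le; first by rewrite addr_ge0// shift_dist_ge0.
move=> g ywg; have [yzg|yzg] := pselect (point_of y g = point_of z g).
  rewrite -[leLHS]add0r lerD ?shift_dist_ge0//.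
  by apply: shift_dist_lb; rewrite -yzg.
rewrite -[leLHS]addr0 lerD ?shift_dist_ge0//.
exact: shift_dist_lb.
Qed.

HB.instance Definition _ := @isMetric.Build R X shift_dist shift_distxx
  shift_dist_positivity shift_dist_sym shift_dist_triangle.

Hypothesis rk_finite : forall n, finite_set [set g | (rk g <= n)%N].

Definition agree (W : seq G) y z := {in W, point_of y =1 point_of z}.

(** As ranks are finite-to-one, the metric induces the product topology. *)
Lemma nbhs_subshiftP y (A : set X) :
  nbhs y A <-> exists W : seq G, forall z, agree W y z -> A z.
Proof.
split=> [|[W WA]].
  rewrite -nbhs_ballE => -[e /= e0 eA].
  have [W Wrk] : exists W : seq G, forall g, (rk g <= Num.trunc e^-1)%N -> g \in W.
    exists (fset_set [set g | (rk g <= Num.trunc e^-1)%N]) => g gn.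
    by rewrite in_fset_set// inE.
  exists W => z yz; apply: eA; rewrite ballEmdist /=.
  rewrite (@le_lt_trans _ _ (Num.trunc e^-1).+2%:R^-1)//.
    apply: shift_dist_le; rewrite ?invr_ge0// => g yzg.
    rewrite lef_pV2 ?posrE// ler_nat ltnS ltnNge; apply/negP => /Wrk gW.
    by apply: yzg; exact: yz.
  rewrite invf_plt ?posrE//.
  rewrite (lt_trans (truncnS_gt _))// ltr_nat//.
pose n := (\max_(g <- W) rk g)%N.
rewrite -nbhs_ballE; exists n.+1%:R^-1; first by rewrite /= invr_gt0.
move=> z; rewrite ballEmdist/= => yzn; apply: WA => g gW; apply: contrapT => yzg.
move: yzn; rewrite ltNge => /negP; apply.
apply: le_trans (shift_dist_lb yzg).
by rewrite lef_pV2 ?posrE// ler_nat ltnS; apply: leq_bigmax_seq.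
Qed.

(** Along an ultrafilter every site has exactly one letter that is eventually
    taken; these letters form the limit. *)
Lemma subshift_compact : compact [set: X].
Proof.
rewrite compact_ultra => U UU _.
have letter g : exists a, U [set y : X | point_of y g = a].
  apply: contrapT => /forallNP noa.
  have : U (\bigcap_(a in [set` [fset a in enum L]%fset])
      ~` [set y : X | point_of y g = a]).
    apply: filter_bigI; rewrite /= => a _.
    have [] // := in_ultra_setVsetC [set y : X | point_of y g = a] UU.
    by move=> /noa.
  by move=> /filter_ex[y /(_ (point_of y g))]; apply => //=; rewrite !inE mem_enum.
have [z Uz] := choice letter.
have UW (W : seq G) : U [set y : X | {in W, point_of y =1 z}].
  elim: W => [|g W IH]; first by apply: filterS filterT => y _ g.
  apply: filterS2 (Uz g) IH => y yg yW h; rewrite inE => /orP[/eqP->//|].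
  exact: yW.
have zP : pattern_closure O z.
  move=> W; have [y yz] := filter_ex (UW W).
  have [p Op yp] := point_ofP y W.
  by exists p => // g gW; rewrite -yz// yp.
exists (Subshift R rk Ol zP); split=> // A /nbhs_subshiftP[W WA].
by apply: filterS (UW W) => y yz; apply: WA => g gW; rewrite yz.
Qed.

Hypothesis O_shift : forall o g, O o -> O (fun h => o (h * g)%g).

Lemma shift_subproof g y : pattern_closure O (fun h => point_of y (h * g)%g).
Proof.
move=> W; have [p Op yp] := point_ofP y [seq (h * g)%g | h <- W].
exists (fun h => p (h * g)%g); first exact: O_shift.
by move=> h hW; apply: yp; exact: map_f.
Qed.

Definition shift_by g y : X := Subshift R rk Ol (shift_subproof g y).

Lemma shift_dynamical_system : dynamical_system (shift_by : G -> X -> X).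
Proof.
split; first exact: subshift_compact.
- by move=> y; apply: point_of_inj; apply/funext => h /=; rewrite mulg1.
- by move=> g h y; apply: point_of_inj; apply/funext => k /=; rewrite mulgA.
move=> g y A /nbhs_subshiftP[W WA].
apply/nbhs_subshiftP; exists [seq (h * g)%g | h <- W] => z yz.
by apply: WA => h hW /=; apply: yz; exact: map_f.
Qed.

Lemma local_continuous (T : topologicalType) (W : seq G) (f : X -> T) :
  (forall y z, agree W y z -> f y = f z) -> continuous f.
Proof.
move=> fW y A /nbhs_singleton Afy.
by apply/nbhs_subshiftP; exists W => z /fW/= <-.
Qed.

End Subshift.

(** * Probabilities as real-valued set functions *)

Section Mass.
Context {d : measure_display} {T : measurableType d} {R : realType}.
Variable mu : probability T R.
Implicit Types A B : set T.

Definition mass A : R := fine (mu A).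

Lemma massE A : measurable A -> (mass A)%:E = mu A.
Proof. by move=> mA; rewrite /mass fineK// fin_num_measure. Qed.

Lemma mass_ge0 A : 0 <= mass A.
Proof. by rewrite fine_ge0. Qed.

Lemma mass0 : mass set0 = 0.
Proof. by rewrite /mass measure0. Qed.

Lemma massT : mass setT = 1.
Proof. by rewrite /mass probability_setT. Qed.

Lemma le_mass A B : measurable A -> measurable B -> A `<=` B -> mass A <= mass B.
Proof.
by move=> mA mB AB; rewrite -lee_fin !massE// le_measure// inE.
Qed.

Lemma massU_le A B : measurable A -> measurable B ->
  mass (A `|` B) <= mass A + mass B.
Proof.
move=> mA mB; rewrite -lee_fin EFinD !massE//; last exact: measurableU.
exact: measureU2.
Qed.

Lemma massU A B : measurable A -> measurable B -> [disjoint A & B] ->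
  mass (A `|` B) = mass A + mass B.
Proof.
move=> mA mB AB; apply: EFin_inj; rewrite EFinD !massE//; last exact: measurableU.
by rewrite measureU//; apply/eqP.
Qed.

Lemma mass_bigU_le (I : choiceType) (s : seq I) (F : I -> set T) :
  (forall i, measurable (F i)) ->
  [/\ measurable (\bigcup_(i in [set` s]) F i) &
    mass (\bigcup_(i in [set` s]) F i) <= \sum_(i <- s) mass (F i)].
Proof.
move=> mF; rewrite bigcup_seq; elim: s => [|i s [mU IH]].
  by rewrite !big_nil mass0.
rewrite !big_cons; split; first exact: measurableU.
by rewrite (le_trans (massU_le _ _))// lerD2l.
Qed.

(** Continuity from above at the empty set. *)
Lemma mass_decreasing_small (F : (set T)^nat) e : 0 < e ->
  (forall n, measurable (F n)) -> (forall n, F n.+1 `<=` F n) ->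
  \bigcap_n F n = set0 -> exists n, mass (F n) <= e.
Proof.
move=> e0 mF ndF F0.
have : mu (F n) @[n --> \oo] --> mu (\bigcap_n F n).
  apply: (@nonincreasing_cvg_mu _ _ _ mu F) => //.
  - by rewrite (le_lt_trans (probability_le1 mu (mF 0%N)))// ltry.
  - by rewrite F0.
  - by apply/nonincreasing_seqP => n; apply/subsetPset.
rewrite F0 measure0 => /fine_cvgP[_ /cvgrPdist_le/(_ _ e0)[n _ /(_ n (leqnn n))]].
rewrite /= sub0r normrN ger0_norm ?fine_ge0// => ?.
by exists n.
Qed.

End Mass.

(** * Approximation of measurable partitions by local functions *)

Section LocalApproximation.
Context {R : realType} {G : groupType} {L : finType} (rk : G -> nat).
Context {O : set (G -> L)} {l : L} (Ol : O (fun=> l)).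
Hypothesis rk_finite : forall n, finite_set [set g | (rk g <= n)%N].

Notation X := (subshift R rk Ol).
Implicit Types (A B : set (borel X)) (mu : probability (borel X) R).

(** Functions of finitely many coordinates; a set is local when it is so as a
    predicate, which amounts to being clopen. *)
Definition local (T : Type) (f : X -> T) :=
  exists W : seq G, forall y z, agree W y z -> f y = f z.

Lemma local2 (T U S : Type) (f : X -> T) (f' : X -> U) (h : T -> U -> S) :
  local f -> local f' -> local (fun y => h (f y) (f' y)).
Proof.
move=> [W fW] [W' fW']; exists (W ++ W') => y z yz.
by rewrite (fW y z) ?(fW' y z)// => g gW; apply: yz; rewrite mem_cat gW ?orbT.
Qed.

Lemma local_open (B : set X) : local B -> open B.
Proof.
move=> [W BW]; rewrite openE => y By; apply/nbhs_subshiftP => //.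
by exists W => z /BW e; rewrite -e.
Qed.

Lemma local_measurable B : local B -> measurable B.
Proof. by move=> ?; apply: sub_gen_smallest; exact: local_open. Qed.

Definition approximable mu A := measurable A /\
  forall e : R, 0 < e -> exists2 B, local B & mass mu (A `+` B) <= e.

Lemma local_approximable mu B : local B -> approximable mu B.
Proof.
move=> lB; split; first exact: local_measurable.
by move=> e e0; exists B; rewrite // setYK mass0 ltW.
Qed.

Lemma approximableC mu A : approximable mu A -> approximable mu (~` A).
Proof.
move=> [mA appA]; split=> [|e /appA[B lB AB]]; first exact: measurableC.
exists (~` B); first by apply: (@local2 _ _ _ B B (fun P _ => ~ P)).
suff -> : ~` A `+` ~` B = A `+` B by [].
by rewrite !setY_def !setDE !setCK setUC (setIC B) (setIC A).
Qed.

Lemma measurableY A B : measurable A -> measurable B -> measurable (A `+` B).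
Proof. by move=> mA mB; rewrite setY_def; apply: measurableU; apply: measurableD. Qed.

Lemma approximableU mu A A' : approximable mu A -> approximable mu A' ->
  approximable mu (A `|` A').
Proof.
move=> [mA appA] [mA' appA']; split=> [|e e0]; first exact: measurableU.
have e2 : 0 < e / 2 by rewrite divr_gt0.
have [B lB AB] := appA _ e2; have [B' lB' AB'] := appA' _ e2.
exists (B `|` B'); first exact: (@local2 _ _ _ B B' or).
have [mB mB'] := (local_measurable lB, local_measurable lB').
rewrite [e]splitr (le_trans _ (lerD AB AB'))//.
apply: le_trans (massU_le mu (measurableY mA mB) (measurableY mA' mB')).
apply: le_mass; first by apply: measurableY; exact: measurableU.
  by apply: measurableU; exact: measurableY.
move=> y; rewrite !setY_def => -[[[Ay|Ay] /not_orP[? ?]]|[[?|?] /not_orP[? ?]]].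
- by left; left.
- by right; left.
- by left; right.
- by right; right.
Qed.

Lemma approximable_bigcup mu (A : (set (borel X))^nat) :
  (forall n, approximable mu (A n)) -> (forall n, A n `<=` A n.+1) ->
  approximable mu (\bigcup_n A n).
Proof.
move=> appA ndA; have mA n : measurable (A n) by case: (appA n).
have mU : measurable (\bigcup_n A n) by exact: bigcupT_measurable.
split=> // e e0; have e2 : 0 < e / 2 by rewrite divr_gt0.
have [n An] : exists n, mass mu ((\bigcup_n A n) `\` A n) <= e / 2.
  apply: mass_decreasing_small => // [n|n y [Uy nA]|].
  - exact: measurableD.
  - by split=> // Ay; apply: nA; exact: ndA.
  - by rewrite -subset0 => y Uy; have [[n _ Any] _] := Uy 0%N I; have [] := Uy n I.
have [B lB AB] := (appA n).2 _ e2; have mB := local_measurable lB.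
exists B => //; rewrite [e]splitr (le_trans _ (lerD An AB))//.
apply: le_trans (massU_le mu (measurableD mU (mA n)) (measurableY (mA n) mB)).
apply: le_mass; first exact: measurableY.
  by apply: measurableU; [exact: measurableD|exact: measurableY].
move=> y; rewrite !setY_def => -[[Uy nB]|[By nU]]; last first.
  by right; right; split=> // Ay; apply: nU; exists n.
have [Ay|nA] := pselect (A n y); first by right; left.
by left.
Qed.

(** An open set is the increasing union of the local sets of those points whose
    cylinder over the sites of rank at most n it contains. *)
Lemma open_approximable mu (A : set X) : open A -> approximable mu A.
Proof.
move=> oA; pose W n : seq G := fset_set [set g | (rk g <= n)%N].
have WP n g : (g \in W n) = (rk g <= n)%N.
  by rewrite in_fset_set//; apply/idP/idP; rewrite inE.
pose An n : set X := [set y | forall z, agree (W n) y z -> A z].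
have -> : A = \bigcup_n An n.
  apply/seteqP; split=> [y Ay|y [n _]]; last by apply.
  move: (open_nbhs_nbhs (conj oA Ay)) => /(nbhs_subshiftP rk_finite)[S SA].
  exists (\max_(g <- S) rk g)%N => // z yz; apply: SA => g gS; apply: yz.
  by rewrite WP; apply: leq_bigmax_seq.
apply: approximable_bigcup => [n|n y yA z yz].
  apply: local_approximable; exists (W n) => y z yz.
  apply/propext; split => H w Hw; apply: H => g gW.
    by rewrite yz// Hw.
  by rewrite -yz// Hw.
by apply: yA => g; rewrite WP => gn; apply: yz; rewrite WP leqW.
Qed.

(** The approximable sets form a sigma-algebra that contains the open sets. *)
Lemma measurable_approximable mu A : measurable A -> approximable mu A.
Proof.
suff : sigma_algebra setT (approximable mu).
  by move=> sA; apply: smallest_sub => // B; exact: open_approximable.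
split.
- by apply: local_approximable; exists [::].
- by move=> B appB; rewrite setTD; exact: approximableC.
move=> F appF; rewrite -bigcup_bigsetU_bigcup; apply: approximable_bigcup => n.
  elim: n.+1 => [|m IH]; first rewrite big_ord0.
    by apply: local_approximable; exists [::].
  by rewrite big_ord_recr; apply: approximableU.
by rewrite [X in _ `<=` X]big_ord_recr; left.
Qed.

(** Approximate each cell P i by a local set B i, and let D pick an index whose
    set contains the point. If D y is not the index of the cell of y, then y lies
    in the symmetric difference of some P j and B j. *)
Lemma partition_local_approx mu (k : nat) (P : 'I_k -> set X) (e : R) : 0 < e ->
  measurable_partition P -> exists2 D : X -> 'I_k, local D &
    mass mu (\bigcup_i (P i `\` D @^-1` [set i])) <= e.
Proof.
move=> e0 [[coverP trivP nP] mP].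
have [i0 _ _] : cover [set: 'I_k] P (point : X) by rewrite coverP.
have k0 : (0 < k)%N by case: (k) i0 => // -[].
have ek : 0 < e / k%:R by rewrite divr_gt0// ltr0n.
have /choice[B BP] i : exists B : set (borel X),
    local B /\ mass mu (P i `+` B) <= e / k%:R.
  by have [B] := (measurable_approximable mu (mP i)).2 _ ek; exists B.
have /choice[W BW] i : exists W : seq G, forall y z, agree W y z -> B i y = B i z.
  exact: (BP i).1.
pose D (y : X) := odflt i0 [pick i | `[< B i y >]].
have lD : local D.
  exists (flatten [seq W i | i <- enum 'I_k]) => y z yz; congr odflt.
  apply: eq_pick => i; congr asbool; apply: BW => g gW; apply: yz.
  by apply/flatten_mapP; exists i; rewrite // mem_enum.
exists D => //.
have mB i : measurable (B i) by apply: local_measurable; case: (BP i).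
have mY i : measurable (P i `+` B i : set (borel X)) by exact: measurableY.
have [mU] := mass_bigU_le mu (enum 'I_k) mY.
have -> : e = \sum_(i <- enum 'I_k) e / k%:R.
  by rewrite big_enum/= sumr_const card_ord -[RHS]mulr_natr divfK// pnatr_eq0 -lt0n.
move=> /le_trans /(_ (ler_sum _ (fun i _ => (BP i).2))); apply: le_trans.
apply: le_mass => //.
  apply: fin_bigcup_measurable => // i _; apply: measurableD => //.
  by apply: local_measurable; apply: (@local2 _ _ _ D D (fun j _ => j = i)).
move=> y [i _ [Py Dy]].
have bad j : (P j `+` B j) y -> (\bigcup_(i in [set` enum 'I_k]) (P i `+` B i)) y.
  by move=> ?; exists j; rewrite //= mem_enum.
have [By|nB] := pselect (B i y); last by apply: (bad i); rewrite setY_def; left.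
move: Dy; rewrite /D /=; case: pickP => [j /asboolP Bj /= ji|/(_ i)/asboolP//].
apply: (bad j); rewrite setY_def; right; split=> // Pj; apply: ji.
by apply: (trivP j i) => //; exists y.
Qed.

End LocalApproximation.

(** * Entropy bounds from codes *)

Lemma continuous_measurable (R : realType) (X Y : pmetricType R) (f : X -> Y)
    (A : set (borel Y)) :
  continuous f -> measurable A -> measurable (f @^-1` A : set (borel X)).
Proof.
move=> cf; pose M : set (set Y) := [set B | measurable (f @^-1` B : set (borel X))].
apply: (smallest_sub (X := M)) => [|B oB].
  split; first by rewrite /M/= preimage_set0.
    by move=> B mB; rewrite /M/= setTD preimage_setC; exact: measurableC.
  by move=> F mF; rewrite /M/= preimage_bigcup; exact: bigcupT_measurable.
by apply: sub_gen_smallest; apply: open_comp => // y _; exact: cf.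
Qed.

Section FiniteValued.
Context {d : measure_display} {T : measurableType d} {R : realType}.
Variable mu : probability T R.

Lemma mass_finite_range (J : finType) (f : T -> J) (Q : pred J) :
  (forall j, measurable (f @^-1` [set j])) ->
  measurable (f @^-1` [set` Q]) /\
  mass mu (f @^-1` [set` Q]) = \sum_(j | Q j) mass mu (f @^-1` [set j]).
Proof.
move=> mf; have eS (s : seq J) : uniq s ->
    measurable (f @^-1` [set` s]) /\
    mass mu (f @^-1` [set` s]) = \sum_(j <- s) mass mu (f @^-1` [set j]).
  elim: s => [_|j s IH /andP[js us]].
    by rewrite big_nil set_nil preimage_set0 mass0.
  have [mS sE] := IH us.
  have -> : f @^-1` [set` j :: s] = f @^-1` [set j] `|` f @^-1` [set` s].
    apply/seteqP; split => y /=; rewrite inE.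
      by move=> /orP[/eqP|]; [left|right].
    by move=> [e|ys]; [rewrite e eqxx|rewrite ys orbT].
  split; first exact: measurableU.
  rewrite big_cons -sE massU//; apply/disj_setPS => y [/= ->].
  by apply/negP.
have -> : [set` Q] = [set` enum Q] by apply/seteqP; split => j /=; rewrite mem_enum.
by have [] := eS (enum Q) (enum_uniq _); rewrite big_enum.
Qed.

End FiniteValued.

Section Gibbs.
Context {R : realType}.

(** From ln t <= t - 1 applied to t = q j / p j, term by term. *)
Lemma gibbs_inequality (J : finType) (p q : J -> R) :
  (forall j, 0 <= p j) -> (forall j, 0 < q j) ->
  \sum_j q j <= \sum_j p j ->
  - (\sum_j p j * ln (p j)) <= \sum_j p j * - ln (q j).
Proof.
move=> p0 q0 qp; rewrite -sumrN -subr_ge0 -sumrB.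
apply: (@le_trans _ _ (\sum_j (p j - q j))); first by rewrite sumrB subr_ge0.
apply: ler_sum => j _.
have [pj|pj] := eqVneq (p j) 0.
  by rewrite pj !mul0r oppr0 subrr sub0r oppr_le0 ltW.
have {}pj : 0 < p j by rewrite lt_neqAle eq_sym pj p0.
have lnqp : ln (q j / p j) <= q j / p j - 1.
  have := @le_ln1Dx _ (q j / p j - 1); rewrite [1 + _]addrCA subrr addr0; apply.
  by rewrite -subr_gt0 opprK subrK divr_gt0.
rewrite -[leLHS]opprB.
have -> : p j * - ln (q j) - - (p j * ln (p j)) =
  - (p j * (ln (q j) - ln (p j))) by ring.
rewrite lerN2 -ln_div ?posrE//.
have -> : q j - p j = p j * (q j / p j - 1).
  by rewrite mulrBr mulr1 mulrCA divff ?mulr1// gt_eqF.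
by rewrite ler_pM2l.
Qed.

End Gibbs.

Section EntropyBound.
Context {R : realType} {G : groupType} {X : pmetricType R} (a : G -> X -> X).
Hypothesis a_dyn : dynamical_system a.
Context (mu : probability (borel X) R) (mu_inv : invariant_measure a mu).
Context (k : nat) (P : 'I_k -> set X) (P_part : measurable_partition P).

Lemma partition_index :
  exists pi : X -> 'I_k, forall i, pi @^-1` [set i] = P i.
Proof.
have [[coverP trivP _] _] := P_part.
have /choice[pi piP] y : exists i, P i y.
  have [i _ Py] : cover [set: 'I_k] P y by rewrite coverP.
  by exists i.
exists pi => i; apply/seteqP; split => [y /= <-//|y Py /=].
by apply: trivP => //; exists y.
Qed.

Variables (D : X -> 'I_k) (E : finType) (code : X -> E) (F : {fset G}).
Hypothesis D_meas : forall i, measurable (D @^-1` [set i] : set (borel X)).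
Hypothesis code_D : forall y z, code y = code z ->
  forall g, g \in F -> D (a g y) = D (a g z).

Variables (del e : R).
Hypothesis del01 : 0 < del < 1.
Hypothesis D_close : mass mu (\bigcup_i (P i `\` D @^-1` [set i])) <= e.

(** A stochastic kernel (in its first argument) that prefers i = j, and an upper
    bound for its code length - ln (kernel i j). *)
Let kernel (i j : 'I_k) : R := (i == j)%:R * (1 - del) + del / k%:R.
Let cost (i j : 'I_k) : R := - ln (1 - del) + (i != j)%:R * ln (k%:R / del).

(** If a code with #|E| values determines the D-name of a point along F, then the
    entropy of the P-name along F is at most ln #|E|, plus a small cost per element
    of F when D is close to P. By gibbs_inequality it suffices to exhibit a
    probability vector q on the P-names with cheap code length: let q be the average,
    over the codes s, of the product of the kernels from the D-name of s. The
    P-name c of a point y with code s then satisfies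
    - ln (q c) <= ln #|E| + sum of the costs of (P-name, D-name) of y along F,
    and by invariance each of these costs has mean at most
    - ln (1 - del) + e * ln (k / del). No conditional entropy is involved, and the
    code need not be measurable. *)
Lemma entropy_code_bound :
  shannon_entropy mu (join_cell a P (F := F)) <=
  ln #|E|%:R + #|` F|%:R * (- ln (1 - del) + e * ln (k%:R / del)).
Proof.
have [pi piE] := partition_index.
have k0 : (0 < k)%N by exact: leq_ltn_trans (leq0n _) (ltn_ord (pi point)).
have /andP[del0 del1] := del01.
have d1 : 0 < 1 - del by rewrite subr_gt0.
have dk : 0 < del / k%:R by rewrite divr_gt0// ltr0n.
have kernel_gt0 i j : 0 < kernel i j.
  by rewrite ltr_wpDl// mulr_ge0// ltW.
have kernel_sum j : \sum_i kernel i j = 1.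
  rewrite big_split/= -big_distrl/= (bigD1 j)//= eqxx big1 ?addr0 => [|i /negbTE->//].
  rewrite mul1r sumr_const card_ord -[_ *+ _]mulr_natr divfK ?subrK//.
  by rewrite pnatr_eq0 -lt0n.
have kernel_cost i j : - ln (kernel i j) <= cost i j.
  rewrite /cost /kernel; case: eqVneq => _ /=.
    rewrite !mul0r addr0 mul1r lerN2 ler_ln ?posrE//; last exact: addr_gt0.
    by rewrite lerDl ltW.
  rewrite mul0r add0r mul1r -lnV ?posrE// invf_div lerDr oppr_ge0 ln_le0//.
  by rewrite gerBl ltW.
have cont g : continuous (a g) by case: a_dyn.
have m_pre g (A : set X) : measurable (A : set (borel X)) ->
    measurable (a g @^-1` A : set (borel X)) by exact: continuous_measurable.
pose J := {ffun F -> 'I_k}.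
pose c (y : borel X) : J := [ffun g => pi (a (val g) y)].
pose dd (y : borel X) : J := [ffun g => D (a (val g) y)].
pose cd y := (c y, dd y).
have m_ffun (f : X -> 'I_k) (t : J) :
    (forall i, measurable (f @^-1` [set i] : set (borel X))) ->
    measurable ((fun y : borel X => [ffun g : F => f (a (val g) y)] : J) @^-1` [set t]).
  move=> mf.
  have -> : (fun y : borel X => [ffun g : F => f (a (val g) y)] : J) @^-1` [set t] =
      \bigcap_(g in [set: F]) (a (val g) @^-1` (f @^-1` [set t g])).
    apply/seteqP; split => y /=; first by move=> <- g _ /=; rewrite ffunE.
    by move=> yt; apply/ffunP => g; rewrite ffunE; exact: yt.
  apply: fin_bigcap_measurable => // g _; exact: m_pre.
have m_c t : measurable (c @^-1` [set t]).
  by apply: m_ffun => i; rewrite piE; case: P_part.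
have m_d t : measurable (dd @^-1` [set t]) by exact: m_ffun.
have m_cd t : measurable (cd @^-1` [set t]).
  have -> : cd @^-1` [set t] = c @^-1` [set t.1] `&` dd @^-1` [set t.2].
    case: t => t1 t2; apply/seteqP; rewrite /cd; split => y /=; first by move=> [<- <-].
    by move=> [-> ->].
  exact: measurableI.
pose p t := mass mu (cd @^-1` [set t]).
have p_ge0 t : 0 <= p t by exact: mass_ge0.
have p_sum (Q : pred (J * J)) : mass mu (cd @^-1` [set` Q]) = \sum_(t | Q t) p t.
  by have [] := mass_finite_range mu Q m_cd.
pose pc t := mass mu (c @^-1` [set t]).
have pcE t : pc t = \sum_u p (t, u).
  have -> : pc t = mass mu (cd @^-1` [set` [pred v : J * J | v.1 == t]]).
    congr mass; apply/seteqP; split => y /=; first by move=> e1; apply/eqP.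
    by move/eqP.
  rewrite p_sum; transitivity (\sum_(i | i == t) \sum_u p (i, u)).
    by rewrite pair_big/=; apply: eq_big => -[i u] //=; rewrite andbT.
  by rewrite big_pred1_eq.
have p_total : \sum_v p v = 1.
  rewrite -(p_sum predT) -(massT mu); congr mass.
  by apply/seteqP; split.
(* A representative of each code; codes that are not attained get an irrelevant
   default point. *)
pose rep s := xget point [set y | code y = s].
have repP y : code (rep (code y)) = code y.
  by apply: (@xgetPex _ point [set z | code z = code y]); exists y.
have E0 : (0 < #|E|)%N by apply/card_gt0P; exists (code point).
have E0R : 0 < #|E|%:R :> R by rewrite ltr0n.
pose weight (t : J) s := \prod_(g : F) kernel (t g) (D (a (val g) (rep s))).
have weight_gt0 t s : 0 < weight t s by exact: prodr_gt0.
pose q t := #|E|%:R^-1 * \sum_(s : E) weight t s.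
have q_lb t s : #|E|%:R^-1 * weight t s <= q t.
  rewrite ler_pM2l ?invr_gt0// (bigD1 s)//= lerDl sumr_ge0// => i _.
  exact: ltW.
have q_gt0 t : 0 < q t.
  by apply: lt_le_trans (q_lb t (code point)); rewrite mulr_gt0// invr_gt0.
have q_sum : \sum_t q t = 1.
  rewrite -mulr_sumr exchange_big/=.
  under eq_bigr => s _.
    rewrite -(bigA_distr_bigA (fun (g : F) i => kernel i (D (a (val g) (rep s)))))/=.
    under eq_bigr => g _ do rewrite kernel_sum.
    rewrite big1_eq; over.
  by rewrite sumr_const -[_ *+ _]mulr_natr mul1r mulVf// gt_eqF.
have ln_prod (f : F -> R) : (forall g, 0 < f g) -> ln (\prod_g f g) = \sum_g ln (f g).
  move=> f0; suff [] : 0 < \prod_g f g /\ ln (\prod_g f g) = \sum_g ln (f g) by [].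
  apply: (big_ind2 (fun u v => 0 < u /\ ln u = v)) => //.
    by rewrite ln1.
  by move=> u u' v v' [u0 <-] [v0 <-]; rewrite mulr_gt0// lnM ?posrE.
(* If the pair of names (t, u) has positive mass, some y has it, and the term of q
   for the code of y gives the bound. *)
have q_cost t u : p (t, u) * - ln (q t) <=
    p (t, u) * (ln #|E|%:R + \sum_(g : F) cost (t g) (u g)).
  have [p0|p0] := eqVneq (p (t, u)) 0; first by rewrite p0 !mul0r.
  have [y yE] : cd @^-1` [set (t, u)] !=set0.
    by apply/set0P; apply: contra_neqN p0 => /eqP e0; rewrite /p e0 mass0.
  rewrite ler_wpM2l//.
  have -> : ln #|E|%:R = - ln (#|E|%:R^-1) :> R by rewrite lnV ?posrE// opprK.
  apply: (@le_trans _ _ (- ln (#|E|%:R^-1 * weight t (code y)))).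
    by rewrite lerN2 ler_ln ?posrE// mulr_gt0// invr_gt0.
  rewrite lnM ?posrE ?invr_gt0// opprD lerD2l /weight ln_prod// -sumrN.
  apply: ler_sum => g _.
  rewrite (code_D (repP y) (valP g)).
  have -> : D (a (val g) y) = u g by move: yE => [_ <-]; rewrite ffunE.
  exact: kernel_cost.
have cost_mean (g : F) : \sum_v p v * cost (v.1 g) (v.2 g) <=
    - ln (1 - del) + e * ln (k%:R / del).
  rewrite /cost; under eq_bigr => v _ do rewrite mulrDr mulrA.
  rewrite big_split/= -!mulr_suml p_total mul1r lerD2l.
  rewrite ler_wpM2r//.
    rewrite ln_ge0// ler_pdivlMr// mul1r (le_trans (ltW del1))//.
    by rewrite ler1n.
  under eq_bigr => v _ do rewrite mulr_natr mulrb.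
  rewrite -big_mkcond/= -p_sum; apply: le_trans D_close.
  have -> : cd @^-1` [set` [pred v : J * J | v.1 g != v.2 g]] =
      a (val g) @^-1` (\bigcup_i (P i `\` D @^-1` [set i])).
    apply/seteqP; split => y /=; rewrite inE /cd /c /dd /= !ffunE.
      move=> /eqP piD; exists (pi (a (val g) y)) => //; split; first by rewrite -piE.
      by move=> /= e'; apply: piD.
    by move=> [i _ []]; rewrite -piE /= => -> iD; apply/eqP => e'; apply: iD.
  rewrite /mass mu_inv//; apply: fin_bigcup_measurable => // i _.
  by apply: measurableD; [case: P_part|].
have -> : shannon_entropy mu (join_cell a P (F := F)) = - (\sum_t pc t * ln (pc t)).
  rewrite /shannon_entropy; congr (- _); apply: eq_bigr => t _.
  have -> // : join_cell a P t = c @^-1` [set t].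
  apply/seteqP; split => y /= yt.
    by apply/ffunP => g; rewrite ffunE; have := yt g I; rewrite /= -piE.
  by move=> g _ /=; rewrite -piE /= -yt ffunE.
apply: (le_trans (gibbs_inequality _ q_gt0 _)).
- by move=> t; exact: mass_ge0.
- rewrite q_sum; under eq_bigr do rewrite pcE.
  by rewrite pair_big/= -[leLHS]p_total; apply: ler_sum => -[].
under eq_bigr do rewrite pcE mulr_suml.
apply: (@le_trans _ _ (\sum_t \sum_u p (t, u) *
    (ln #|E|%:R + \sum_(g : F) cost (t g) (u g)))).
  by apply: ler_sum => t _; apply: ler_sum => u _; exact: q_cost.
rewrite pair_big/=; under eq_bigr => v _.
  rewrite mulrDr -surjective_pairing mulr_sumr; over.
rewrite big_split/= -mulr_suml p_total mul1r lerD2l exchange_big/=.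
apply: (@le_trans _ _ (\sum_(g : F) (- ln (1 - del) + e * ln (k%:R / del)))).
  by apply: ler_sum => g _; exact: cost_mean.
by rewrite sumr_const -[_ *+ _]mulr_natl cardfE.
Qed.

End EntropyBound.

(** * Subshifts of low complexity have zero entropy *)

Section ShannonNonneg.
Context {R : realType} {X : pmetricType R} (mu : probability (borel X) R).

Lemma shannon_entropy_ge0 (J : finType) (Q : J -> set X) :
  (forall j, measurable (Q j : set (borel X))) -> 0 <= shannon_entropy mu Q.
Proof.
move=> mQ; rewrite /shannon_entropy -sumrN sumr_ge0// => j _.
rewrite -mulrN mulr_ge0 ?fine_ge0// oppr_ge0 ln_le0//.
rewrite -lee_fin fineK ?fin_num_measure//; exact: probability_le1.
Qed.

End ShannonNonneg.

Lemma folner_translates (R : realType) (G : groupType) (F : nat -> {fset G})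
    (K : {fset G}) : folner R F -> K != fset0 ->
  \forall n \near \oo,
    (#|` [fset (k * f)%g | k in K, f in F n]%fset| <= 2 * #|` F n|)%N.
Proof.
move=> [F0 FK] /FK/cvgrPdist_le/(_ _ ltr01) near1.
apply: filterS near1 => n; set KF := [fset _ | _ in _, _ in _]%fset.
have Fn0 : (0 < #|` F n|)%N by rewrite cardfs_gt0.
rewrite sub0r normrN ger0_norm ?divr_ge0// ler_pdivrMr ?ltr0n// mul1r ler_nat.
move=> le_F.
rewrite mul2n -addnn -(cardfsID (F n) KF) leq_add//.
  by rewrite fsubset_leq_card// fsubsetIr.
by rewrite (leq_trans _ le_F)// fsubset_leq_card// fsubsetUl.
Qed.

(** Since the tiling by the translates u b is exact, codes for the words on single
    tiles combine into a code for the pattern on any finite set, the logarithm of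
    whose size is at most eta times the number of sites of the tiles involved.
    Codes, rather than numbers of words, are what entropy_code_bound consumes. *)
Definition low_complexity (R : realType) (G : groupType) (L : Type)
    (O : set (G -> L)) :=
  forall eta : R, 0 < eta ->
  exists (A : {fset G}) (B : set G) (E : finType) (dec : E -> G -> L),
  [/\ A != fset0,
      forall g, exists u b, [/\ u \in A, B b & g = (u * b)%g],
      forall u u' b b', u \in A -> u' \in A -> B b -> B b' ->
        (u * b = u' * b')%g -> u = u' /\ b = b',
      ln #|E|%:R <= eta * #|` A|%:R
    & forall o : G -> L, O o -> exists e, forall h, h \in A -> o h = dec e h].

Section ZeroEntropy.
Context {R : realType} {G : groupType} {L : finType} (rk : G -> nat).
Context {O : set (G -> L)} {l : L} (Ol : O (fun=> l)).
Hypothesis rk_finite : forall n, finite_set [set g | (rk g <= n)%N].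
Hypothesis O_shift : forall o g, O o -> O (fun h => o (h * g)%g).
Hypothesis O_low : low_complexity R O.

Notation X := (subshift R rk Ol).
Notation a := (shift_by O_shift : G -> X -> X).

(** For local D, the D-name of a point along F depends on the sites w g with w in a
    fixed window W and g in F. The tiles A b that meet these sites cover them, and
    the word on each tile takes only #|E| values. These tiles are disjoint subsets of
    K F for K = A A^-1 W, so that there are at most #|K F| / #|A| of them. *)
Lemma pattern_code (T : Type) (D : X -> T) (eta : R) : local D -> 0 < eta ->
  exists2 K : {fset G}, K != fset0 & forall F : {fset G},
    exists (E : finType) (code : X -> E),
      ln #|E|%:R <= eta * #|` [fset (k * f)%g | k in K, f in F]%fset|%:R /\
      forall y z, code y = code z -> forall g, g \in F -> D (a g y) = D (a g z).
Proof.
move=> [W DW] eta0.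
have [A [B [E [dec [A0 tileA uniqA lnE decP]]]]] := O_low eta0.
have /choice[al /choice[be albe]] := tileA.
pose K1 := [fset (u * u'^-1)%g | u in A, u' in A]%fset.
pose K := (1%g |` [fset (k * w)%g | k in K1, w in W])%fset.
exists K => [|F].
  by apply/fset0Pn; exists 1%g; rewrite !inE eqxx.
pose T_F := [fset be (w * g)%g | w in W, g in F]%fset.
have pat (y : X) (b : T_F) : exists e,
    forall h, h \in A -> point_of y (h * val b)%g = dec e h.
  have [p Op yp] := point_ofP (a (val b) y) A.
  have [e eP] := decP _ Op; exists e => h hA; rewrite -eP// -yp//.
have /choice[pc pcP] (y : X) : exists f : {ffun T_F -> E},
    forall b h, h \in A -> point_of y (h * val b)%g = dec (f b) h.
  have /choice[f fP] := pat y; exists [ffun b => f b] => b h.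
  by rewrite ffunE; exact: fP.
exists {ffun T_F -> E}, pc; split; last first.
  move=> y z yz g gF; apply: DW => w wW /=.
  have [uA Bb ->] := albe (w * g)%g.
  have bT : be (w * g)%g \in T_F by apply/imfset2P; exists w => //; exists g.
  by rewrite (pcP y [` bT]%fset)// (pcP z [` bT]%fset)// yz.
have E0 : (0 < #|E|)%N.
  have [e _] := decP _ Ol.
  by apply/card_gt0P; exists e.
rewrite card_ffun natrX lnXn ?ltr0n// -cardfE -[leLHS]mulr_natr.
rewrite (le_trans (ler_wpM2r (ler0n _ _) lnE))// -mulrA ler_wpM2l//.
  exact: ltW.
rewrite -natrM ler_nat [#|` T_F|]cardfE [#|` A|]cardfE -card_prod [leqRHS]cardfE.
have sub (p : A * T_F) :
    (val p.1 * val p.2)%g \in [fset (k * f)%g | k in K, f in F]%fset.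
  have /imfset2P[w wW [f fF bE]] := valP p.2; rewrite bE.
  have [uA _ e] := albe (w * f)%g.
  apply/imfset2P; exists (val p.1 * (al (w * f))^-1 * w)%g; last first.
    exists f => //; rewrite -!mulgA; congr (_ * _)%g.
    by rewrite [X in (_ = _ * X)%g]e mulKg.
  rewrite /= !inE; apply/orP; right; apply/imfset2P.
  exists (val p.1 * (al (w * f))^-1)%g; last by exists w.
  apply/imfset2P; exists (val p.1); first exact: (valP p.1).
  by exists (al (w * f)%g).
apply: (@leq_card _ _ (fun p => [` sub p]%fset)).
move=> [u b] [u' b'] /(congr1 val)/= e.
have Bb (c : T_F) : B (val c).
  by have /imfset2P[w _ [f _ ->]] := valP c; have [] := albe (w * f)%g.
have [uu bb] := uniqA _ _ _ _ (valP u) (valP u') (Bb b) (Bb b') e.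
by congr pair; exact: val_inj.
Qed.

Let a_dyn : dynamical_system a.
Proof. exact: shift_dynamical_system. Qed.

Lemma join_cell_measurable (k : nat) (P : 'I_k -> set X) (F : {fset G}) c :
  measurable_partition P -> measurable (join_cell a P (F := F) c : set (borel X)).
Proof.
move=> [_ mP]; apply: fin_bigcap_measurable => // g _.
by apply: continuous_measurable => //; case: a_dyn.
Qed.

(** The bound entropy_code_bound is split into three parts: pattern_code and the
    Folner property bound the term ln #|E| by eta / 2 per element of F n, and del
    and the precision of D are chosen such that - ln (1 - del) = eta / 4 and the
    remaining cost is at most eta / 4. *)
Lemma partition_entropy0 (F : nat -> {fset G}) (mu : probability (borel X) R)
    (k : nat) (P : 'I_k -> set X) :
  folner R F -> invariant_measure a mu -> measurable_partition P ->
  partition_entropy F a mu P = 0.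
Proof.
move=> F_folner mu_inv P_part; apply: cvg_lim => //.
apply/cvgrPdist_le => eta eta0.
have eta4 : 0 < eta / 4 by rewrite divr_gt0.
pose del := 1 - expR (- (eta / 4)).
have del01 : 0 < del < 1.
  by rewrite subr_gt0 -[ltRHS]expR0 ltr_expR oppr_lt0 eta4 /= gtrBl expR_gt0.
pose l1 := ln (k%:R / del).
have l10 : 0 < 1 + `|l1| by rewrite ltr_pwDl.
have e0 : 0 < eta / 4 / (1 + `|l1|) by rewrite divr_gt0.
have [D lD PD] := partition_local_approx rk_finite mu e0 P_part.
have D_meas i : measurable (D @^-1` [set i] : set (borel X)).
  by apply: local_measurable => //; apply: (local2 (fun j _ => j = i) lD lD).
have [K K0 Kcode] := pattern_code lD eta4.
apply: filterS (folner_translates F_folner K0) => n.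
set KF := [fset _ | _ in _, _ in _]%fset => le_KF.
have Fn0 : 0 < #|` F n|%:R :> R by rewrite ltr0n cardfs_gt0 F_folner.1.
have [E [code [lnE codeD]]] := Kcode (F n).
have := entropy_code_bound a_dyn mu_inv P_part D_meas codeD del01 PD.
set S := shannon_entropy _ _ => Sle.
have S0 : 0 <= S.
  by apply: shannon_entropy_ge0 => c; exact: join_cell_measurable.
rewrite sub0r normrN ger0_norm ?divr_ge0//.
rewrite ler_pdivrMr// (le_trans Sle)//.
have lnE2 : ln #|E|%:R <= eta / 2 * #|` F n|%:R.
  rewrite (le_trans lnE)//.
  have : #|` KF|%:R <= 2 * #|` F n|%:R :> R by rewrite -natrM ler_nat.
  by move=> /(ler_wpM2l (ltW eta4)); lra.
have cost : - ln (1 - del) + eta / 4 / (1 + `|l1|) * l1 <= eta / 2.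
  rewrite /del subKr expRK opprK.
  have : eta / 4 / (1 + `|l1|) * l1 <= eta / 4.
    rewrite -mulrA -[leRHS]mulr1 ler_wpM2l ?(ltW eta4)// mulrC ler_pdivrMr// mul1r.
    by rewrite (le_trans (ler_norm _))// lerDr.
  lra.
have := ler_wpM2l (ltW Fn0) cost; rewrite -/l1; lra.
Qed.

(** The supremum over invariant measures that defines the topological entropy is
    taken over a nonempty set because of the fixed point. *)
Lemma const_point_invariant :
  invariant_measure a (\d_(const_point rk Ol : borel X) : probability (borel X) R).
Proof.
move=> g A mA; rewrite [LHS]diracE [RHS]diracE; congr (_%:R%:E); congr nat_of_bool.
have fix_c : a g (const_point rk Ol) = const_point rk Ol by exact: point_of_inj.
by apply/idP/idP; rewrite !inE /preimage/= fix_c.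
Qed.

Theorem subshift_zero_entropy : amenable R G -> zero_entropy a.
Proof.
move=> G_amenable; split=> // F F_folner.
have h0 mu : invariant_measure a mu -> measure_entropy F a mu = 0%E.
  move=> mu_inv; rewrite /measure_entropy.
  have -> : [set h | exists (k : nat) (P : 'I_k -> set X), measurable_partition P /\
      h = (partition_entropy F a mu P)%:E] = [set 0%E]; last exact: ereal_sup1.
  apply/seteqP; split => [_ [k [P [P_part ->]]]|_ ->].
    by rewrite (partition_entropy0 F_folner mu_inv P_part).
  have P_part : measurable_partition (fun _ : 'I_1 => [set: X]).
    split=> [|i]; last exact: measurableT.
    split=> [|i j _ _ _|i _]; last by exists (point : X).
      by apply/seteqP; split => // y _; exists ord0.
    by rewrite (ord1 i) (ord1 j).
  by exists 1%N, (fun=> setT); rewrite (partition_entropy0 F_folner mu_inv P_part).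
rewrite /topological_entropy.
have -> : measure_entropy F a @` invariant_measure a = [set 0%E].
  apply/seteqP; split => [_ [mu mu_inv <-]|_ ->]; first exact: h0.
  by eexists; [exact: const_point_invariant|apply: h0; exact: const_point_invariant].
exact: ereal_sup1.
Qed.

End ZeroEntropy.

(** * Automatic functions *)

(** Because exp t = (exp (t / 2))^2 >= (t / 2)^2. *)
Lemma ln_affine_sublinear (R : realType) (C : nat) (eta : R) : 0 < eta ->
  exists N0 : nat, forall N, (N0 <= N)%N -> ln (N * C).+1%:R <= eta * N%:R.
Proof.
move=> eta0; exists (Num.trunc (4 * C.+1%:R / eta ^+ 2)).+1 => N N0N.
have N1 : (0 < N)%N by exact: leq_trans N0N.
have N_large : C.+1%:R <= eta ^+ 2 / 4 * N%:R :> R.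
  have : 4 * C.+1%:R / eta ^+ 2 <= N%:R.
    by rewrite (le_trans (ltW (truncnS_gt _)))// ler_nat.
  by rewrite ler_pdivrMr ?exprn_gt0// => ?; lra.
rewrite -[leRHS]expRK ler_ln ?posrE ?expR_gt0//.
have -> : expR (eta * N%:R) = expR (eta * N%:R / 2) ^+ 2.
  by rewrite -expRM_natl; congr expR; lra.
have half_ge0 : 0 <= eta * N%:R / 2 by rewrite divr_ge0// mulr_ge0// ltW.
apply: (@le_trans _ _ ((eta * N%:R / 2) ^+ 2)); last first.
  rewrite lerXn2r ?nnegrE ?expR_ge0// (le_trans _ (expR_ge1Dx _))//.
  by rewrite lerDr.
apply: (@le_trans _ _ (C.+1%:R * N%:R)).
  by rewrite -natrM ler_nat mulSn addnC mulnC -addn1 leq_add2l.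
have -> : (eta * N%:R / 2) ^+ 2 = eta ^+ 2 / 4 * N%:R * N%:R by field.
by rewrite ler_wpM2r.
Qed.

(** The constant configuration gives the closure a fixed point of the shift, and
    hence an invariant measure. *)
Definition orbit_and_const (G : groupType) (L : Type) (x : G -> L) (l : L) :
    set (G -> L) :=
  [set o : G -> L | (exists a, o = fun h => x (h * a)%g) \/ o = fun=> l].

Lemma automatic_low_complexity (R : realType) (G : groupType)
    (H : {multiplicative G -> G}) (V : set G) (Lam : finType) (x : G -> Lam) (l : Lam) :
  infinite_set [set: G] -> finite_set V -> good_complete_digit_set H V ->
  automatic H V x -> low_complexity R (orbit_and_const x l).
Proof.
move=> G_inf V_fin V_good x_aut eta eta0.
have [V_complete _] := V_good; have [V_res _] := V_complete.
have [C codeC] := automatic_complexity V_res V_fin V_complete V_good x_aut.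
have [N0 N0P] := ln_affine_sublinear C eta0.
have [m m0 /N0P mP] := tile_unbounded V_res V_fin V_complete N0 G_inf.
have [E [dec [E_card decP]]] := codeC m m0.
exists (tile H V m), (range (iter m H)), (option E), (fun e h => oapp (dec^~ h) l e).
split.
- by apply/fset0Pn; exists 1%g; apply: tile1.
- move=> g; have [u [k [um ->]]] := tile_dec V_res V_fin m g.
  by exists u, (iter m H k); split=> //; exists k.
- move=> u u' _ _ um um' [k _ <-] [k' _ <-] /(tile_uniq V_res V_fin um um')[-> ->].
  by [].
- by rewrite card_option E_card.
move=> _ [[a ->]|->]; last by exists None.
by have [e eP] := decP a; exists (Some e).
Qed.

Theorem corollary7p7 (R : realType) (G : groupType) (N : G -> R)
    (H : {multiplicative G -> G}) (V : set G)
    (Lam : finType) (iota : Lam -> R) (x : G -> Lam)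
    (G_infinite : infinite_set [set: G]%classic)
    (G_fg : finitely_generated G)
    (N_norm : group_norm N)
    (H_expanding : expanding N H)
    (H_index : finite_index (range H))
    (V_good : good_complete_digit_set H V)
    (iota_inj : injective iota)
    (G_amenable : amenable R G)
    (x_automatic : automatic H V x) :
  strongly_deterministic (fun g => iota (x g)).
Proof.
have [V_complete _] := V_good; have [V_res _] := V_complete.
have V_fin : finite_set V by exact: residue_set_finite V_res H_index.
pose O := orbit_and_const x (x 1%g).
have Ol : O (fun=> x 1%g) by right.
have O_shift p g : O p -> O (fun h => p (h * g)%g).
  move=> [[a ->]|->]; last by right.
  by left; exists (g * a)%g; apply/funext => h; rewrite mulgA.
have Ord_finite n : finite_set [set g | (Ord H V g <= n)%N].
  apply: sub_finite_set (finite_fset (tile H V n.+1)) => g /=.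
  by rewrite Ord_leq.
have Ox : pattern_closure O x.
  by move=> W; exists x => //; left; exists 1%g; apply/funext => h; rewrite mulg1.
exists (subshift R (Ord H V) Ol), (shift_by O_shift),
  (fun y => iota (point_of y 1%g)), (Subshift R (Ord H V) Ol Ox).
split.
- exact: shift_dynamical_system.
- apply: subshift_zero_entropy => //.
  exact: automatic_low_complexity V_fin V_good x_automatic.
- apply: (local_continuous Ord_finite (W := [:: 1%g])) => y z yz.
  by rewrite yz// inE.
by move=> g /=; rewrite mul1g.
Qed.
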